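(* Let $M\ge2$, $n=(n_1,\dots,n_M)$ with $n_l\in\mathbb{N}$ positive integers. The algebra $\mathcal{F}_n$ of (complex polynomial) functions on $\mathbb{R}^{2M}$ which are in involution with the oscillator $H_0=\frac12\sum_{l=1}^M n_l(q_l^2+p_l^2)$ is a finitely generated involutive Poisson algebra. After the identification $$\mathcal{A}_\alpha\leftrightarrow z^{\alpha_+}\overline z^{\alpha_-}\ (\alpha\in\Gamma_n),\qquad \mathcal{A}_{I_j}\leftrightarrow |z_j|^2\ (j=1,\dots,M),$$ these elements generate $\mathcal{F}_n$, satisfy $\overline{\mathcal{A}_\alpha}=\mathcal{A}_{-\alpha}$, $\overline{\mathcal{A}_{I_j}}=\mathcal{A}_{I_j}$, and the constraints and Poisson brackets of this algebra are of polynomial type and are given by $$\mathcal{A}_\alpha\mathcal{A}_\beta=\mathcal{A}_I^{\alpha\overset{\circ}{+}\beta}\prod_{\gamma\in\Gamma_n}\mathcal{A}_\gamma^{\mu_{\alpha,\beta,\gamma}},\qquad \{\mathcal{A}_\alpha,\mathcal{A}_\beta\}=i\,\overset{\circ}{\Phi}_{\alpha\beta}(\mathcal{A}_I)\prod_{\gamma\in\Gamma_n}\mathcal{A}_\gamma^{\mu_{\alpha,\beta,\gamma}},\qquad \alpha,\beta\in\Gamma_n,$$ $$\{\mathcal{A}_\alpha,\mathcal{A}_{I_j}\}=i\alpha_j\mathcal{A}_\alpha,\qquad \{\mathcal{A}_{I_l},\mathcal{A}_{I_j}\}=0,\qquad l,j=1,\dots,M.$$ These brackets are arithmetic: all the structural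 coefficients (that is, the coefficients of the polynomials $\overset{\circ}{\Phi}_{\alpha\beta}$ and the numbers $\alpha_j$) are integers. The functional dimension $N$ of $\mathcal{F}_n$, i.e. the number of minimal generators $\mathcal{A}_\alpha$ ($\alpha\in\Gamma_n$) and $\mathcal{A}_{I_j}$ ($1\le j\le M$), is finite: $N=\#(\Gamma_n)+M$.
   Context: Coordinates on $\mathbb{R}^{2M}$ are $(q,p)$ and $z_l=\frac1{\sqrt2}(q_l+ip_l)$. The Poisson bracket is normalized so that $\{z_l,\overline z_j\}=i\delta_{lj}$, $\{z_l,z_j\}=0$, i.e. $\{f,g\}=\sum_l\big(\frac{\partial f}{\partial p_l}\frac{\partial g}{\partial q_l}-\frac{\partial f}{\partial q_l}\frac{\partial g}{\partial p_l}\big)$. ''Involutive'' means closed under complex conjugation, which satisfies $\overline{\{f,g\}}=\{\overline f,\overline g\}$. ''In involution with $H_0$'' means having zero Poisson bracket with $H_0$. For $a\in\mathbb{Z}_+^M$ (nonnegative integers), $z^a=\prod_l z_l^{a_l}$, $\lambda^a=\prod_l\lambda_l^{a_l}$, and $\mathcal{A}_I^{a}=\prod_l\mathcal{A}_{I_l}^{a_l}$; products of integer vectors are componentwise, and $a\circ b=\sum_l a_lb_l$. For $\alpha\in\mathbb{Z}^M$, $\alpha_+,\alpha_-\in\mathbb{Z}_+^M$ are the componentwise positive and negative parts, $\alpha=\alpha_+-\alpha_-$, $\alpha_+\alpha_-=0$. $\Gamma_n\subset\mathbb{Z}^M$ is the set of minimal solutions of the resonance equation $n\circ\alpha=0$: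 those nonzero $\alpha\in\mathbb{Z}^M$ with $n\circ\alpha=0$ for which $(\alpha_+,\alpha_-)$ is not the sum of two nonzero elements $(k_+,k_-)\in\mathbb{Z}_+^M\times\mathbb{Z}_+^M$ satisfying $n\circ(k_+-k_-)=0$. For $\alpha,\beta\in\mathbb{Z}^M$: $[\alpha,\beta]=\alpha_+\beta_--\alpha_-\beta_+\in\mathbb{Z}^M$ (componentwise) and $\alpha\overset{\circ}{+}\beta=\min(\alpha_++\beta_+,\alpha_-+\beta_-)\in\mathbb{Z}_+^M$ (componentwise minimum). For $\alpha,\beta\in\Gamma_n$, the numbers $\mu_{\alpha,\beta,\gamma}\in\mathbb{Z}_+$ ($\gamma\in\Gamma_n$) are the coefficients of a (chosen) expansion $$\alpha_\pm+\beta_\pm=\sum_{\gamma\in\Gamma_n}\mu_{\alpha,\beta,\gamma}\,\gamma_\pm+(\alpha\overset{\circ}{+}\beta)\quad\text{(for both signs)},$$ and $$\overset{\circ}{\Phi}_{\alpha\beta}(\lambda)=\lambda^{\alpha\overset{\circ}{+}\beta}\sum_{l=1}^M\frac{[\alpha,\beta]_l}{\lambda_l},\qquad\lambda\in\mathbb{R}^M .$$ *)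

(* Defs.v *)
From HB Require Import structures.
From mathcomp Require Import all_boot all_order all_algebra.
From mathcomp Require Export complex.
From mathcomp Require Export reals.
From mathcomp Require Export mpoly.

Set Implicit Arguments.
Unset Strict Implicit.
Unset Printing Implicit Defensive.

Import Order.TTheory GRing.Theory Num.Theory.
Local Open Scope ring_scope.

Section IntegerVectors.
Variable M : nat.

Definition Zvec := {ffun 'I_M -> int}.
Definition Nvec := {ffun 'I_M -> nat}.

Implicit Types (n : 'I_M -> nat) (a b : Zvec) (k : Nvec * Nvec).

Definition pospart a : Nvec := [ffun l => `|Num.max (a l) 0|%N].
Definition negpart a : Nvec := [ffun l => `|Num.max (- a l) 0|%N].

Definition resonant n a : Prop := \sum_l (n l)%:Z * a l = 0.

Definition diffvec k : Zvec := [ffun l => (k.1 l)%:Z - (k.2 l)%:Z].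

(* Membership in Gamma_n. The two summands are arbitrary pairs of nonnegative
   vectors; addition and zero are those of the product monoid. *)
Definition minimal_solution n a : Prop :=
  [/\ a != 0, resonant n a &
   ~ exists k k' : Nvec * Nvec,
       [/\ k != 0, k' != 0, resonant n (diffvec k), resonant n (diffvec k') &
        (pospart a, negpart a) = k + k']].

(* [alpha, beta] *)
Definition zbracket a b : Zvec :=
  [ffun l => (pospart a l * negpart b l)%N%:Z
           - (negpart a l * pospart b l)%N%:Z].

(* alpha with-circled-plus beta *)
Definition circ_add a b : Nvec :=
  [ffun l => minn (pospart a l + pospart b l) (negpart a l + negpart b l)].

(* [mu a b c] is only constrained for a, b, c in Gamma. *)
Definition is_expansion (Gamma : seq Zvec) (mu : Zvec -> Zvec -> Zvec -> nat) :
    Prop :=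
  forall a b, a \in Gamma -> b \in Gamma ->
    pospart a + pospart b
      = \sum_(c <- Gamma) pospart c *+ mu a b c + circ_add a b
  /\ negpart a + negpart b
      = \sum_(c <- Gamma) negpart c *+ mu a b c + circ_add a b.

(* The formula for Phi_{alpha beta}; since MathComp sets x / 0 = 0, it is the
   intended value only at points with all coordinates nonzero. *)
Definition PhiCirc (R : fieldType) a b (lambda : 'I_M -> R) : R :=
  (\prod_l lambda l ^+ circ_add a b l)
    * \sum_l (zbracket a b l)%:~R / lambda l.

End IntegerVectors.

Section PoissonAlgebras.
Variables (K : numClosedFieldType) (A : comAlgType K).
Variable F : {pred A}.

(* F is a subalgebra of A (with unit), closed under br and star, on which br is
   a Poisson bracket and star is an antilinear involution compatible with the
   product and with br. *)
Record involutive_poisson_algebra (br : A -> A -> A) (star : A -> A) : Prop :=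
  InvolutivePoissonAlgebra {
    ipa_subalg : subalg_closed F;
    ipa_br : {in F &, forall f g, br f g \in F};
    ipa_brDl : forall c, {in F & &, forall f g h,
      br (c *: f + g) h = c *: br f h + br g h};
    ipa_brC : {in F &, forall f g, br f g = - br g f};
    ipa_leibniz : {in F & &, forall f g h,
      br f (g * h) = br f g * h + g * br f h};
    ipa_jacobi : {in F & &, forall f g h,
      br f (br g h) + br g (br h f) + br h (br f g) = 0};
    ipa_star : {in F, forall f, star f \in F};
    ipa_starK : {in F, forall f, star (star f) = f};
    ipa_starD : forall c, {in F &, forall f g,
      star (c *: f + g) = Num.conj c *: star f + star g};
    ipa_starM : {in F &, forall f g, star (f * g) = star f * star g};
    ipa_star_br : {in F &, forall f g, star (br f g) = br (star f) (star g)}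
  }.

(* F is the unital commutative algebra generated by the list s. *)
Definition generates (s : seq A) : Prop :=
  forall f : A, f \in F <->
    exists P : {mpoly K[size s]}, f = mmap (in_alg A) (fun i => s`_i) P.

Definition finitely_generated : Prop := exists s : seq A, generates s.

(* N is the least number of generators of F. *)
Definition functional_dimension (N : nat) : Prop :=
  (exists2 s : seq A, size s = N & generates s) /\
  (forall s : seq A, generates s -> (N <= size s)%N).

End PoissonAlgebras.

Section Oscillator.
Variables (R : realType) (M : nat).

(* Complex polynomial functions on R^(2M), as polynomials with coefficients in
   R[i] in the real coordinates (q, p): the first M variables are the q_l, the
   last M are the p_l. Since R is infinite, a polynomial is determined by the
   function it defines on R^(2M). *)
Definition polyfun := {mpoly R[i][M + M]}.

Implicit Types (f g : polyfun) (n : 'I_M -> nat) (a : Zvec M) (l : 'I_M).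

Definition qX l : polyfun := 'X_(lshift M l).
Definition pX l : polyfun := 'X_(rshift M l).

(* The coordinates are real, so conjugating the function is conjugating the
   coefficients. *)
Definition pconj f : polyfun := map_mpoly Num.conj f.

Definition dq l f : polyfun := mderiv (lshift M l) f.
Definition dp l f : polyfun := mderiv (rshift M l) f.

Definition pbracket f g : polyfun :=
  \sum_l (dp l f * dq l g - dq l f * dp l g).

Definition iC : R[i] := 'i.

Definition zX l : polyfun :=
  (Num.sqrt (2 : R))^-1%:C%C *: (qX l + iC *: pX l).

Definition H0 n : polyfun :=
  2^-1 *: \sum_l (n l)%:R *: (qX l ^+ 2 + pX l ^+ 2).

Definition Falg n : {pred polyfun} := [pred f | pbracket f (H0 n) == 0].

Definition gen_A a : polyfun :=
  \prod_l (zX l ^+ pospart a l * pconj (zX l) ^+ negpart a l).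

Definition gen_I l : polyfun := zX l * pconj (zX l).

(* A_I^k *)
Definition gen_I_exp (k : Nvec M) : polyfun := \prod_l gen_I l ^+ k l.

(* P(A_I) *)
Definition eval_I (P : {mpoly int[M]}) : polyfun := mmap intr gen_I P.

Definition generators (Gamma : seq (Zvec M)) : seq polyfun :=
  [seq gen_A a | a <- Gamma] ++ [seq gen_I l | l <- enum 'I_M].

End Oscillator.
Arguments iC {R}.
Arguments gen_A R {M} a.
Arguments gen_I R {M} l.
Arguments gen_I_exp R {M} k.
Arguments eval_I R {M} P.
Arguments generators R {M} Gamma.
Arguments Falg R {M} n.

(* Main.v *)
(* In the coordinates z, conj z (an algebra automorphism of C[q, p], [zsubst])
   the monomial z^x conj(z)^y is an eigenvector of {., H0} with eigenvalue
   i n.(x - y).  So F_n is spanned by the monomials with resonant exponent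
   (x, y), and it is generated by those whose exponent is irreducible in the
   monoid of resonant pairs.  The irreducible pairs are (alpha+, alpha-) for
   alpha in Gamma_n and (e_l, e_l).  They are finitely many: if alpha_l exceeds
   the sum of the n_k, then either some (alpha-)_k >= n_l, and
   (n_k e_l, n_l e_k) splits off, or all (alpha-)_k < n_l, and
   n.alpha+ = n.alpha- fails.
     The coefficients at the irreducible exponents are derivations of F_n at the
   origin, because an irreducible exponent is only a sum of resonant ones in the
   two trivial ways.  They are linearly independent on the generators, so no
   smaller family generates F_n. *)

Require Import Defs.
From HB Require Import structures.
From mathcomp Require Import all_boot all_order all_algebra.
From mathcomp Require boolp.
From mathcomp Require Import zify ring.
Import Order.TTheory GRing.Theory Num.Theory.
Local Open Scope ring_scope.

Set Implicit Arguments.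
Unset Strict Implicit.
Unset Printing Implicit Defensive.

(** * Resonant exponents *)

Section ResonantMonoid.
Variables (M : nat) (n : 'I_M -> nat).
Implicit Types (m k : 'X_{1..M + M}) (a : Zvec M) (l : 'I_M).

(** A pair of exponents (x, y) is packed into one multinomial, so that z^x conj(z)^y is a single
    monomial in [M + M] variables and the multinomial arithmetic applies to pairs. *)
Definition mnm_pair (x y : 'I_M -> nat) : 'X_{1..M + M} :=
  [multinom match split i with inl l => x l | inr l => y l end | i < M + M].

Lemma mnm_pairl x y l : mnm_pair x y (lshift M l) = x l.
Proof. by rewrite mnmE (unsplitK (inl l)). Qed.

Lemma mnm_pairr x y l : mnm_pair x y (rshift M l) = y l.
Proof. by rewrite mnmE (unsplitK (inr l)). Qed.

Definition mnm_pairE := (mnm_pairl, mnm_pairr).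

Lemma mnm_pairP m k :
  (forall l, m (lshift M l) = k (lshift M l)) ->
  (forall l, m (rshift M l) = k (rshift M l)) -> m = k.
Proof.
by move=> el er; apply/mnmP => i; rewrite -(splitK i); case: (split i).
Qed.

Definition mnm_res m : bool :=
  (\sum_l n l * m (lshift M l) == \sum_l n l * m (rshift M l))%N.

Lemma mnm_res_resonant (k : Nvec M * Nvec M) :
  resonant n (diffvec k) <-> mnm_res (mnm_pair k.1 k.2).
Proof.
rewrite /resonant /mnm_res.
rewrite (eq_bigr (fun l => ((n l * k.1 l)%N%:Z - (n l * k.2 l)%N%:Z))); last first.
  by move=> l _; rewrite ffunE mulrBr !PoszM.
rewrite sumrB -!(big_morph Posz PoszD (erefl _)).
under [X in _ <-> is_true (X == _)]eq_bigr do rewrite mnm_pairl.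
under [X in _ <-> is_true (_ == X)]eq_bigr do rewrite mnm_pairr.
split=> [/eqP|/eqP ->]; last by rewrite subrr.
by rewrite subr_eq0.
Qed.

(** The resonance equation is additive and cancellative. Hence whatever remains after removing a
    resonant part from a resonant exponent is again resonant, which is how exponents are split
    below. *)
Lemma mnm_resDr m k : mnm_res m -> mnm_res (m + k)%MM = mnm_res k.
Proof.
rewrite /mnm_res => /eqP mE.
under eq_bigr do rewrite mnmDE mulnDr.
rewrite big_split /= mE; under [X in _ == X]eq_bigr do rewrite mnmDE mulnDr.
by rewrite big_split /= eqn_add2l.
Qed.

Lemma mnm_res0 : mnm_res 0%MM.
Proof.
by apply/eqP; apply: eq_bigr => l _; rewrite !mnm0E.
Qed.

(** These are the atoms of the monoid of resonant exponents. *)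
Definition mnm_irr m : Prop :=
  [/\ m != 0%MM, mnm_res m & forall k k', mnm_res k -> mnm_res k' ->
    m = (k + k')%MM -> k = 0%MM \/ k' = 0%MM].

Definition mnm_vec a := mnm_pair (pospart a) (negpart a).
Definition mnm_I l := (U_(lshift M l) + U_(rshift M l))%MM : 'X_{1..M + M}.

Lemma pospartN a : pospart (- a) = negpart a.
Proof. by apply/ffunP => l; rewrite !ffunE. Qed.

Lemma negpartN a : negpart (- a) = pospart a.
Proof. by apply/ffunP => l; rewrite !ffunE opprK. Qed.

Lemma pos_negpart a l : a l = (pospart a l)%:Z - (negpart a l)%:Z.
Proof. rewrite !ffunE; lia. Qed.

Lemma pos_negpart_min a l : minn (pospart a l) (negpart a l) = 0%N.
Proof. rewrite !ffunE; lia. Qed.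

Lemma mnm_vec_inj : injective mnm_vec.
Proof.
move=> a b /mnmP e; apply/ffunP => l.
rewrite !pos_negpart.
by have := e (lshift M l); have := e (rshift M l); rewrite !mnm_pairE => -> ->.
Qed.

Lemma mnm_vec0 : mnm_vec 0 = 0%MM.
Proof. by apply: mnm_pairP => l; rewrite mnm_pairE mnm0E !ffunE. Qed.

Lemma mnm_vec_I a l : mnm_vec a != mnm_I l.
Proof.
apply/eqP => e; have := pos_negpart_min a l.
have := congr1 (fun m : 'X_{1..M + M} => m (lshift M l)) e.
have := congr1 (fun m : 'X_{1..M + M} => m (rshift M l)) e.
rewrite /= !mnm_pairE !mnmDE !mnm1E !eqxx => -> ->.
by rewrite addnS minnSS.
Qed.

Lemma mnm_I_l l j : mnm_I l (lshift M j) = (l == j).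
Proof. by rewrite mnmDE !mnm1E eq_lshift eq_rlshift addn0. Qed.

Lemma mnm_I_r l j : mnm_I l (rshift M j) = (l == j).
Proof. by rewrite mnmDE !mnm1E eq_rshift eq_lrshift. Qed.

Lemma mnm_I_inj : injective mnm_I.
Proof.
move=> l k /mnmP /(_ (lshift M l)); rewrite !mnm_I_l eqxx.
by case: eqP => [->|].
Qed.

Lemma mnm_res_I l : mnm_res (mnm_I l).
Proof. by apply/eqP; apply: eq_bigr => k _; rewrite mnm_I_l mnm_I_r. Qed.

Lemma minimal_solutionP a : minimal_solution n a <-> mnm_irr (mnm_vec a).
Proof.
have aE : a = diffvec (pospart a, negpart a).
  by apply/ffunP => l; rewrite [RHS]ffunE; apply: pos_negpart.
have pair0 (k : Nvec M * Nvec M) : mnm_pair k.1 k.2 = 0%MM -> k = 0.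
  case: k => x y /= /mnmP e; congr pair; apply/ffunP => l; rewrite !ffunE.
    by have := e (lshift M l); rewrite mnm_pairl mnm0E.
  by have := e (rshift M l); rewrite mnm_pairr mnm0E.
split=> [[a0 ares amin]|[a0 ares amin]].
  split.
  - by rewrite -mnm_vec0 (inj_eq mnm_vec_inj).
  - by move: ares; rewrite {1}aE mnm_res_resonant.
  - move=> k k' kr kr' e.
    have [|k0] := eqVneq k 0%MM; first by left.
    have [|k0'] := eqVneq k' 0%MM; first by right.
    case: amin.
    (* [P] unpacks a multinomial into a pair; it is inverse to [mnm_pair] and carries a splitting of
       the packed exponent back to pairs. *)
    pose P m : Nvec M * Nvec M :=
      ([ffun l => m (lshift M l)], [ffun l => m (rshift M l)]).
    have PK (m : 'X_{1..M + M}) : mnm_pair (P m).1 (P m).2 = m.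
      by apply: mnm_pairP => l; rewrite mnm_pairE ffunE.
    have P0 m : m != 0%MM -> P m != 0.
      apply: contraNneq => e0; rewrite -(PK m) e0.
      by apply/eqP/mnm_pairP => l; rewrite mnm_pairE mnm0E !ffunE.
    exists (P k), (P k'); split; rewrite ?P0 ?mnm_res_resonant ?PK //.
    move/mnmP: e => e; congr pair; apply/ffunP => l.
      by have := e (lshift M l); rewrite mnm_pairE mnmDE !ffunE.
    by have := e (rshift M l); rewrite mnm_pairE mnmDE !ffunE.
split.
- by move: a0; rewrite -mnm_vec0 (inj_eq mnm_vec_inj).
- by rewrite aE mnm_res_resonant.
- case=> k [k' [k0 k0' kr kr' e]].
  case: (amin (mnm_pair k.1 k.2) (mnm_pair k'.1 k'.2)).
  + exact/mnm_res_resonant.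
  + exact/mnm_res_resonant.
  + by case: e => e1 e2; apply: mnm_pairP => l;
      rewrite mnmDE !mnm_pairE ?e1 ?e2 ffunE.
  + by move/pair0 => e0; rewrite e0 eqxx in k0.
  + by move/pair0 => e0; rewrite e0 eqxx in k0'.
Qed.

Lemma minimal_solutionN a : minimal_solution n a -> minimal_solution n (- a).
Proof.
rewrite /minimal_solution pospartN negpartN => -[a0 ares amin].
have resN b : resonant n b -> resonant n (- b).
  rewrite /resonant => e; rewrite (eq_bigr (fun l => - ((n l)%:Z * b l))).
    by rewrite sumrN e oppr0.
  by move=> l _; rewrite ffunE mulrN.
have swapN (k : Nvec M * Nvec M) : diffvec (k.2, k.1) = - diffvec k.
  by apply/ffunP => l; rewrite !ffunE opprB.
split; rewrite ?oppr_eq0 //; first exact: resN.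
case=> -[x y] [[x' y'] [k0 k0' kr kr' [e1 e2]]]; apply: amin.
have k0s (u v : Nvec M) : (u, v) != 0 -> (v, u) != 0.
  by apply: contraNneq => -[-> ->].
exists (y, x), (y', x'); split.
- exact: k0s.
- exact: k0s.
- by rewrite (swapN (x, y)); apply: resN.
- by rewrite (swapN (x', y')); apply: resN.
- by rewrite e1 e2.
Qed.

(** If both exponents at some l are positive, the resonant [mnm_I l] splits off, and irreducibility
    leaves nothing else. Otherwise the two halves have disjoint supports, so they are the positive
    and negative parts of their difference. *)
Lemma mnm_irr_cases m : mnm_irr m ->
  (exists l, m = mnm_I l) \/ (exists2 a, minimal_solution n a & m = mnm_vec a).
Proof.
move=> mirr; have [m0 mr mmin] := mirr.
case: (boolP [exists l, (0 < m (lshift M l)) && (0 < m (rshift M l))]%N).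
  case/existsP => l /andP[ml mr']; left; exists l.
  have e : m = (mnm_I l + (m - mnm_I l))%MM.
    apply: mnm_pairP => k; rewrite mnmDE mnmBE ?mnm_I_l ?mnm_I_r;
    case: (eqVneq l k) => [<-|_] /=; lia.
  have r : mnm_res (m - mnm_I l)%MM.
    by rewrite -(mnm_resDr _ (mnm_res_I l)) -e.
  case: (mmin _ _ (mnm_res_I l) r e) => [|e0].
    by move/eqP; rewrite mnmD_eq0 mnm1_eq0.
  by rewrite e e0 addm0.
move=> /existsPn dis; right.
have e : m = mnm_vec [ffun l => (m (lshift M l))%:Z - (m (rshift M l))%:Z].
  by apply: mnm_pairP => l; rewrite mnm_pairE !ffunE; move: (dis l); lia.
exists [ffun l => (m (lshift M l))%:Z - (m (rshift M l))%:Z] => //.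
by apply/minimal_solutionP; rewrite -e.
Qed.

(** Strong induction on the degree: a nonzero reducible exponent is a sum of two nonzero resonant
    ones, both of smaller degree. *)
Lemma mnm_res_decomp m : mnm_res m ->
  exists2 s : seq 'X_{1..M + M}, (forall k, k \in s -> mnm_irr k) &
    m = (\sum_(k <- s) k)%MM.
Proof.
have [d] := ubnP (mdeg m); elim: d m => // d IH m md mr.
have [->|m0] := eqVneq m 0%MM; first by exists [::] => //; rewrite big_nil.
case: (boolp.pselect (mnm_irr m)) => [mi|mni].
  by exists [:: m] => [k|]; [rewrite inE => /eqP -> | rewrite big_seq1].
have [k [k' [kr kr' e k0 k0']]] : exists k k', [/\ mnm_res k, mnm_res k',
    m = (k + k')%MM, k != 0%MM & k' != 0%MM].
  apply: boolp.contra_notP mni => nd; split=> // k k' kr kr' e.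
  have [|k0] := eqVneq k 0%MM; first by left.
  have [|k0'] := eqVneq k' 0%MM; first by right.
  by case: nd; exists k, k'.
move: md k0 k0'; rewrite -!mdeg_eq0 -!lt0n e mdegD => md k0 k0'.
case: (IH k) => // [|s si sE]; first by lia.
case: (IH k') => // [|s' si' sE']; first by lia.
exists (s ++ s') => [x|]; last by rewrite big_cat /= -sE -sE'.
by rewrite mem_cat => /orP[/si|/si'].
Qed.

Section Positive.
Hypothesis n_gt0 : forall l, (0 < n l)%N.

(** The degree is 2, so a proper splitting would have two summands of degree 1. None of these is
    resonant, since its weight is a single [n j], which is positive. *)
Lemma mnm_irr_I l : mnm_irr (mnm_I l).
Proof.
split; [by rewrite mnmD_eq0 mnm1_eq0 | exact: mnm_res_I |].
move=> k k' kr kr' e.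
have nres1 (x : 'X_{1..M + M}) : mdeg x = 1%N -> ~~ mnm_res x.
  move=> /eqP /mdeg1P[i /eqP ->]; rewrite -(splitK i) /mnm_res.
  case: (split i) => j /=.
  - rewrite [X in _ == X]big1; last by move=> h _; rewrite mnm1E eq_lrshift muln0.
    rewrite (bigD1 j) //= mnm1E eqxx muln1 addn_eq0.
    by rewrite eqn0Ngt n_gt0.
  - rewrite big1; last by move=> h _; rewrite mnm1E eq_rlshift muln0.
    rewrite (bigD1 j) //= mnm1E eqxx muln1 eq_sym addn_eq0.
    by rewrite eqn0Ngt n_gt0.
have d2 : (mdeg k + mdeg k' = 2)%N by rewrite -mdegD -e mdegD !mdeg1.
have d1 : mdeg k <> 1%N by move=> /nres1; rewrite kr.
have : mdeg k == 0%N \/ mdeg k' == 0%N by lia.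
by rewrite !mdeg_eq0 => -[/eqP|/eqP]; [left|right].
Qed.

Lemma pospart_bound a l : minimal_solution n a ->
  (pospart a l <= \sum_k n k)%N.
Proof.
move=> /minimal_solutionP[m0 mr mmin].
rewrite leqNgt; apply/negP => lt.
have yk (k : 'I_M) : (negpart a k < n l)%N.
  rewrite ltnNge; apply/negP => le.
  (* The pair (n_k e_l, n_l e_k), both of whose halves have weight n_k n_l. It fits under a because
     a_l exceeds the sum of the n_j, hence n_k, and (a_-)_k is at least n_l. *)
  pose x := mnm_pair (fun j => (n k * (l == j))%N) (fun j => (n l * (k == j))%N).
  have nk : (n k <= \sum_k n k)%N by rewrite (bigD1 k) //= leq_addr.
  have xr : mnm_res x.
    apply/eqP.
    rewrite (bigD1 l) //= big1 ?addn0; last first.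
      by move=> j /negPf jl; rewrite mnm_pairE eq_sym jl !muln0.
    rewrite [RHS](bigD1 k) //= big1 ?addn0; last first.
      by move=> j /negPf jl; rewrite mnm_pairE eq_sym jl !muln0.
    by rewrite !mnm_pairE !eqxx !muln1 mulnC.
  have e : mnm_vec a = (x + (mnm_vec a - x))%MM.
    apply: mnm_pairP => j; rewrite mnmDE mnmBE !mnm_pairE.
      by case: eqP => [<-|_]; lia.
    by case: eqP => [<-|_]; lia.
  have r : mnm_res (mnm_vec a - x)%MM by rewrite -(mnm_resDr _ xr) -e.
  (* Neither summand vanishes: at the coordinate l of the first half, [x] is n_k > 0 and the rest is
     a_l - n_k > 0. *)
  case: (mmin _ _ xr r e) => /mnmP.
    move/(_ (lshift M l)); rewrite mnm_pairE mnm0E eqxx muln1 => e0.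
    by have := n_gt0 k; rewrite e0.
  by move/(_ (lshift M l)); rewrite mnmBE !mnm_pairE mnm0E eqxx; lia.
move/eqP: mr => mr.
(* Now n_l a_l <= n.a_+ = n.a_- <= (sum of the n_j) n_l, and cancelling n_l contradicts the assumed
   size of a_l. *)
have le1 : (n l * pospart a l <= \sum_j n j * pospart a j)%N.
  by rewrite [leqRHS](bigD1 l) //= leq_addr.
have le2 : (\sum_j n j * negpart a j <= (\sum_j n j) * n l)%N.
  by rewrite big_distrl /= leq_sum // => j _; rewrite leq_mul2l (ltnW (yk j)) orbT.
move: mr; under eq_bigr do rewrite mnm_pairE.
under [X in _ = X]eq_bigr do rewrite mnm_pairE.
move=> mr; rewrite mr in le1; have := leq_trans le1 le2.
by rewrite mulnC leq_pmul2r // leqNgt lt.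
Qed.

Lemma minimal_solution_finite : exists2 Gamma : seq (Zvec M),
  uniq Gamma & forall a, a \in Gamma <-> minimal_solution n a.
Proof.
pose B := (\sum_k n k)%N.
(* The bound for a and for -a puts every entry in [-B, B]. Shifting by B lands in the finite type
   ['I_(B + B).+1], so [E] lists the whole box, from which the minimal solutions are selected
   classically. *)
pose E := [seq [ffun l => (f l)%:Z - B%:Z] : Zvec M
             | f : {ffun 'I_M -> 'I_(B + B).+1} <- enum {ffun 'I_M -> 'I_(B + B).+1}].
exists (undup [seq a <- E | boolp.asbool (minimal_solution n a)]).
  exact: undup_uniq.
move=> a; rewrite mem_undup mem_filter.
split=> [/andP[/boolp.asboolP]|amin] //.
apply/andP; split; first exact/boolp.asboolP.
apply/mapP; exists [ffun l => inord (absz (a l + B%:Z))]; first by rewrite mem_enum.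
apply/ffunP => l; rewrite !ffunE.
have := pospart_bound l amin; have := pospart_bound l (minimal_solutionN amin).
rewrite pospartN -/B => h1 h2.
have e := pos_negpart a l.
by rewrite inordK e; lia.
Qed.

End Positive.
End ResonantMonoid.

(** * Polynomial algebras: induction over generators and the chain rule *)

Section MPolyAlgebra.
Variables (K : comNzRingType) (d : nat).

Lemma mpoly_alg_ind (P : {mpoly K[d]} -> Prop) :
  (forall c p q, P p -> P q -> P (c *: p + q)) -> P 1 ->
  (forall p q, P p -> P q -> P (p * q)) -> (forall i, P 'X_i) ->
  forall p, P p.
Proof.
move=> Plin P1 PM PX.
have P0 : P 0 by have := Plin (-1) 1 1 P1 P1; rewrite scaleN1r addNr.
apply: mpolyind => // c m p _ _ Pp; apply: Plin => //.
rewrite mpolyXE_id; apply: big_ind => // i _.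
by elim: (m i) => [|k IH]; rewrite ?expr0 // exprS; apply: PM.
Qed.

Lemma mpoly_lrmorph_eq (A : algType K) (f g : {lrmorphism {mpoly K[d]} -> A}) :
  (forall i, f 'X_i = g 'X_i) -> f =1 g.
Proof.
move=> fg; apply: mpoly_alg_ind => [c p q ep eq||p q ep eq|i].
- by rewrite !linearP /= ep eq.
- by rewrite !rmorph1.
- by rewrite !rmorphM /= ep eq.
- exact: fg.
Qed.

(** The chain rule. Both sides are linear and obey the same Leibniz rule along the substitution, so
    it suffices to compare them on the variables. *)
Lemma mderiv_comp e (s : d.-tuple {mpoly K[e]}) (i : 'I_e) (p : {mpoly K[d]}) :
  (p \mPo s)^`M(i) = \sum_j (p^`M(j) \mPo s) * (tnth s j)^`M(i).
Proof.
elim/mpoly_alg_ind: p => [c p q ep eq||p q ep eq|k].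
- rewrite !linearP /= ep eq scaler_sumr -big_split; apply: eq_bigr => j _ /=.
  by rewrite !linearP /= mulrDl scalerAl.
- rewrite rmorph1 -!mpolyC1 mderivC big1 // => j _.
  by rewrite mderivC raddf0 mul0r.
- rewrite rmorphM /= mderivM ep eq mulr_suml mulr_sumr -big_split.
  apply: eq_bigr => j _ /=; rewrite mderivM rmorphD !rmorphM /=; ring.
- rewrite comp_mpolyXU (bigD1 k) //= big1 => [|j jk].
    rewrite mderivX mnm1E eqxx scale1r addr0 -{1}[U_(k)%MM]add0m addmK.
    rewrite mpolyX0 rmorph1 mul1r.
    by rewrite -tnth_nth.
  by rewrite mderivX mnm1E eq_sym (negPf jk) scale0r raddf0 mul0r.
Qed.

End MPolyAlgebra.

(** * The canonical Poisson bracket *)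

Section CanonicalBracket.
Variables (K : comNzRingType) (A : comAlgType K) (I : finType).
Variables (P Q : I -> {linear A -> A}).
Hypotheses (PM : forall l f g, P l (f * g) = P l f * g + f * P l g)
  (QM : forall l f g, Q l (f * g) = Q l f * g + f * Q l g)
  (PP : forall l k f, P l (P k f) = P k (P l f))
  (QQ : forall l k f, Q l (Q k f) = Q k (Q l f))
  (PQ : forall l k f, P l (Q k f) = Q k (P l f)).

(** Built from arbitrary families of linear maps: the Poisson identities need only that these are
    commuting derivations. With the partial derivatives in p and q it is [pbracket] up to
    conversion. *)
Definition canonical_bracket (f g : A) := \sum_l (P l f * Q l g - Q l f * P l g).
Local Notation br := canonical_bracket.

Lemma canonical_bracketC f g : br f g = - br g f.
Proof. by rewrite /br -sumrN; apply: eq_bigr => l _; ring. Qed.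

Lemma canonical_bracketDl c f g h : br (c *: f + g) h = c *: br f h + br g h.
Proof.
rewrite /br scaler_sumr -big_split; apply: eq_bigr => l _ /=.
by rewrite !linearP scalerBr !scalerAl; ring.
Qed.

Lemma canonical_bracketDr c f g h : br h (c *: f + g) = c *: br h f + br h g.
Proof.
rewrite canonical_bracketC canonical_bracketDl opprD -scalerN.
by rewrite -!(canonical_bracketC h).
Qed.

Lemma canonical_bracket0 f : br 0 f = 0.
Proof. by rewrite /br big1 // => l _; rewrite !raddf0 !mul0r subrr. Qed.

Lemma canonical_bracket_suml (J : finType) (c : J -> K) (F : J -> A) g :
  br (\sum_j c j *: F j) g = \sum_j c j *: br (F j) g.
Proof.
elim/big_rec2: _ => [|j u v _ IH]; first exact: canonical_bracket0.
by rewrite canonical_bracketDl IH.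
Qed.

Lemma canonical_bracketM f g h : br f (g * h) = br f g * h + g * br f h.
Proof.
rewrite /br mulr_suml mulr_sumr -big_split; apply: eq_bigr => l _ /=.
rewrite PM QM; ring.
Qed.

(** Each nested bracket is a double sum over (l, k). The cyclic sum of the (l, k) terms cancels
    against that of the (k, l) terms, so twice the Jacobi expression is zero; [double0] removes the
    factor 2. *)
Lemma canonical_bracket_jacobi :
  (forall f : A, f + f = 0 -> f = 0) ->
  forall f g h, br f (br g h) + br g (br h f) + br h (br f g) = 0.
Proof.
move=> double0 f g h.
(* The (l, k) term of [br u (br v w)] after the Leibniz rule, with every mixed second derivative
   written with [Q] outside [P]. *)
pose T (u v w : A) l k :=
   P l u * (P k v * Q l (Q k w) + Q l (P k v) * Q k w
              - Q k v * Q l (P k w) - Q l (Q k v) * P k w)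
    - Q l u * (P k v * Q k (P l w) + P l (P k v) * Q k w
              - Q k v * P l (P k w) - Q k (P l v) * P k w).
have expand (u v w : A) : br u (br v w) = \sum_l \sum_k T u v w l k.
  apply: eq_bigr => l _.
  rewrite /br !raddf_sum /= !mulr_sumr -sumrB.
  apply: eq_bigr => k _; rewrite /T !raddfB /= !PM !QM !PQ; ring.
have TT u v w l k : 
  (T u v w l k + T v w u l k + T w u v l k)
  + (T u v w k l + T v w u k l + T w u v k l) = 0.
  rewrite /T. rewrite !(PP l k) !(QQ l k). ring.
rewrite !expand -!big_split /=.
apply: double0.
under eq_bigr do rewrite -!big_split /=.
(* The second copy of the double sum is summed in the other order, which pairs (l, k) with (k,
   l). *)
rewrite [X in _ + X]exchange_big -big_split big1 //= => l _.
by rewrite -big_split big1 //= => k _.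
Qed.
Lemma canonical_bracket_morph (s : {rmorphism A -> A}) :
  (forall l f, s (P l f) = P l (s f)) -> (forall l f, s (Q l f) = Q l (s f)) ->
  forall f g, s (br f g) = br (s f) (s g).
Proof.
move=> sP sQ f g; rewrite rmorph_sum; apply: eq_bigr => l _.
by rewrite rmorphB !rmorphM /= !sP !sQ.
Qed.

End CanonicalBracket.

Section Bracket.
Variables (R : realType) (M : nat).
Local Notation C := R[i].
Local Notation poly := (polyfun R M).
Implicit Types (f g h : poly) (l : 'I_M).
Local Notation br := (@pbracket R M).

Let P l : {linear poly -> poly} := mderiv (rshift M l).
Let Q l : {linear poly -> poly} := mderiv (lshift M l).

Lemma pbracketC f g : br f g = - br g f.
Proof. exact: (canonical_bracketC P Q). Qed.

Lemma pbracketDl c f g h : br (c *: f + g) h = c *: br f h + br g h.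
Proof. exact: (canonical_bracketDl P Q). Qed.

Lemma pbracketDr c f g h : br h (c *: f + g) = c *: br h f + br h g.
Proof. exact: (canonical_bracketDr P Q). Qed.

Lemma pbracketM f g h : br f (g * h) = br f g * h + g * br f h.
Proof. by apply: (@canonical_bracketM _ _ _ P Q) => l u v; apply: mderivM. Qed.

Lemma pbracket_jacobi f g h :
  br f (br g h) + br g (br h f) + br h (br f g) = 0.
Proof.
apply: (@canonical_bracket_jacobi _ _ _ P Q) => [l u v|l u v|l k u|l k u|l k u|u uu].
- exact: mderivM.
- exact: mderivM.
- exact: mderiv_comm.
- exact: mderiv_comm.
- exact: mderiv_comm.
apply/mpolyP => m; have /eqP := congr1 (mcoeff m) uu.
by rewrite mcoeffD mcoeff0 -mulr2n mulrn_eq0 /= => /eqP.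
Qed.

HB.instance Definition _ := GRing.RMorphism.copy (@pconj R M) (map_mpoly Num.conj).

Lemma pconjP c f g : pconj (c *: f + g) = Num.conj c *: pconj f + pconj g.
Proof. by rewrite /pconj raddfD /= map_mpolyZ. Qed.

Lemma pconjM f g : pconj (f * g) = pconj f * pconj g.
Proof. exact: rmorphM. Qed.

Lemma pconjK : involutive (@pconj R M).
Proof.
by move=> f; apply/mpolyP => m; rewrite !mcoeff_map_mpoly /= conjCK.
Qed.

Lemma mderiv_pconj (i : 'I_(M + M)) f : mderiv i (pconj f) = pconj (mderiv i f).
Proof.
apply/mpolyP => m.
by rewrite mcoeff_mderiv !mcoeff_map_mpoly mcoeff_mderiv raddfMn.
Qed.

Lemma pconj_br f g : pconj (br f g) = br (pconj f) (pconj g).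
Proof.
apply: (@canonical_bracket_morph _ _ _ P Q (@pconj R M)) => l u;
  symmetry; exact: mderiv_pconj.
Qed.

End Bracket.

(** * Complex coordinates *)

Section ComplexCoordinates.
Variables (K : comNzRingType) (M : nat) (r i : K).
Hypotheses (rr : r * r * 2 = 1) (ii : i * i = -1).
Local Notation poly := {mpoly K[M + M]}.
Implicit Types (f g : poly) (l k : 'I_M).
Let P l : {linear poly -> poly} := mderiv (rshift M l).
Let Q l : {linear poly -> poly} := mderiv (lshift M l).
Local Notation br := (canonical_bracket P Q).

(* Before substitution the variables lshift l and rshift l stand for z_l and its
   conjugate, after it for q_l and p_l; r and i are 1/sqrt 2 and the imaginary
   unit. *)
Definition zsubst_tuple : (M + M).-tuple poly :=
  [tuple match split j with
         | inl l => r *: ('X_(lshift M l) + i *: 'X_(rshift M l))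
         | inr l => r *: ('X_(lshift M l) - i *: 'X_(rshift M l)) end
     | j < M + M].

Definition zsubst f : poly := f \mPo zsubst_tuple.

HB.instance Definition _ := GRing.LRMorphism.copy zsubst (comp_mpoly zsubst_tuple).

(** The real coordinates recovered from the complex ones: q_l in the first half and p_l in the
    second. *)
Definition zsubst_inv_tuple : (M + M).-tuple poly :=
  [tuple match split j with
         | inl l => r *: ('X_(lshift M l) + 'X_(rshift M l))
         | inr l => (- r * i) *: ('X_(lshift M l) - 'X_(rshift M l)) end
     | j < M + M].

Definition zsubst_inv f : poly := f \mPo zsubst_inv_tuple.

HB.instance Definition _ :=
  GRing.LRMorphism.copy zsubst_inv (comp_mpoly zsubst_inv_tuple).

Lemma zsubst_tuplel l : tnth zsubst_tuple (lshift M l) =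
  r *: ('X_(lshift M l) + i *: 'X_(rshift M l)).
Proof. by rewrite tnth_mktuple (unsplitK (inl l)). Qed.

Lemma zsubst_tupler l : tnth zsubst_tuple (rshift M l) =
  r *: ('X_(lshift M l) - i *: 'X_(rshift M l)).
Proof. by rewrite tnth_mktuple (unsplitK (inr l)). Qed.

Lemma zsubst_Xl l : zsubst 'X_(lshift M l) =
  r *: ('X_(lshift M l) + i *: 'X_(rshift M l)).
Proof. by rewrite /zsubst comp_mpolyXU -tnth_nth zsubst_tuplel. Qed.

Lemma zsubst_Xr l : zsubst 'X_(rshift M l) =
  r *: ('X_(lshift M l) - i *: 'X_(rshift M l)).
Proof. by rewrite /zsubst comp_mpolyXU -tnth_nth zsubst_tupler. Qed.

Lemma zsubst_inv_Xl l : zsubst_inv 'X_(lshift M l) =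
  r *: ('X_(lshift M l) + 'X_(rshift M l)).
Proof.
by rewrite /zsubst_inv comp_mpolyXU -tnth_nth tnth_mktuple (unsplitK (inl l)).
Qed.

Lemma zsubst_inv_Xr l : zsubst_inv 'X_(rshift M l) =
  (- r * i) *: ('X_(lshift M l) - 'X_(rshift M l)).
Proof.
by rewrite /zsubst_inv comp_mpolyXU -tnth_nth tnth_mktuple (unsplitK (inr l)).
Qed.

Section ScalarIdentities.
Variables (A : lmodType K) (x y : A).

(** By [rr], [r * r] plays the role of one half in a ring without division. *)
Lemma half_sum_diff : (r * r) *: (x + y) + (r * r) *: (x - y) = x.
Proof.
by rewrite -scalerDr addrACA subrr addr0 -mulr2n -scaler_nat scalerA rr scale1r.
Qed.

Lemma half_sum_diffN : (r * r) *: (x + y) - (r * r) *: (x - y) = y.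
Proof.
rewrite -scalerBr opprB [x + y]addrC addrACA subrr addr0.
by rewrite -mulr2n -scaler_nat scalerA rr scale1r.
Qed.

End ScalarIdentities.

Lemma zsubstK : cancel zsubst zsubst_inv.
Proof.
have E1 : r * i * (- r * i) = r * r 
  by transitivity (- (r * r) * (i * i)); [ring | rewrite ii; ring].
apply: (@mpoly_lrmorph_eq _ _ _ (zsubst_inv \o zsubst) idfun) => j /=.
rewrite -(splitK j); case: (split j) => l /=.
  rewrite zsubst_Xl linearZ_LR linearD linearZ_LR /= zsubst_inv_Xl zsubst_inv_Xr.
  by rewrite scalerDr !scalerA E1 half_sum_diff.
rewrite zsubst_Xr linearZ_LR linearB linearZ_LR /= zsubst_inv_Xl zsubst_inv_Xr.
by rewrite scalerBr !scalerA E1 half_sum_diffN.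
Qed.

Lemma zsubst_invK : cancel zsubst_inv zsubst.
Proof.
have E1 : - r * i * r = - (r * r * i) by ring.
have E0 : - (r * r * i) * i = r * r.
  by transitivity (- (r * r) * (i * i)); [ring | rewrite ii; ring].
have E2 (x : poly) : - (r * r * i) *: (i *: x) = (r * r) *: x.
  by rewrite scalerA E0.
apply: (@mpoly_lrmorph_eq _ _ _ (zsubst \o zsubst_inv) idfun) => j /=.
rewrite -(splitK j); case: (split j) => l /=.
  rewrite zsubst_inv_Xl linearZ_LR linearD /= zsubst_Xl zsubst_Xr.
  by rewrite scalerDr !scalerA half_sum_diff.
rewrite zsubst_inv_Xr linearZ_LR linearB /= zsubst_Xl zsubst_Xr.
rewrite -scalerBr scalerA E1 opprB addrC addrA subrK -scalerDr E2.
by rewrite -mulr2n -scaler_nat scalerA rr scale1r.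
Qed.

(** This and the next lemma are the Wirtinger relations between d/dq, d/dp and d/dz, d/d(conj z).
    Inside [zsubst], [Q l] and [P l] differentiate in z_l and its conjugate. *)
Lemma mderiv_zsubstl l f : Q l (zsubst f) = r *: zsubst (Q l f + P l f).
Proof.
have Xl k : (tnth zsubst_tuple (lshift M k))^`M(lshift M l) = ((k == l)%:R * r)%:MP.
  rewrite zsubst_tuplel mderivZ mderivD mderivZ !mderivX !mnm1E eq_lshift eq_rlshift.
  rewrite scale0r scaler0 addr0.
  have [->|_] := eqVneq k l; last by rewrite scale0r scaler0 mul0r.
  by rewrite -{1}[U_(_)%MM]add0m addmK mpolyX0 mul1r scale1r -mul_mpolyC mulr1.
have Xr k : (tnth zsubst_tuple (rshift M k))^`M(lshift M l) = ((k == l)%:R * r)%:MP.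
  rewrite zsubst_tupler mderivZ mderivB mderivZ !mderivX !mnm1E eq_lshift eq_rlshift.
  rewrite scale0r scaler0 subr0.
  have [->|_] := eqVneq k l; last by rewrite scale0r scaler0 mul0r.
  by rewrite -{1}[U_(_)%MM]add0m addmK mpolyX0 mul1r scale1r -mul_mpolyC mulr1.
rewrite [LHS]mderiv_comp big_split_ord /= (bigD1 l) //= big1 => [|k kl]; last first.
  by rewrite Xl (negPf kl) mul0r mulr0.
rewrite (bigD1 l) //= big1 => [|k kl]; last first.
  by rewrite Xr (negPf kl) mul0r mulr0.
rewrite Xl Xr eqxx mul1r !addr0 -mulrDl mulrC mul_mpolyC; congr (_ *: _).
by rewrite /zsubst linearD.
Qed.

Lemma mderiv_zsubstr l f :
  P l (zsubst f) = (r * i) *: zsubst (Q l f - P l f).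
Proof.
have Xl k : (tnth zsubst_tuple (lshift M k))^`M(rshift M l) =
    ((k == l)%:R * (r * i))%:MP.
  rewrite zsubst_tuplel mderivZ mderivD mderivZ !mderivX !mnm1E eq_rshift eq_lrshift.
  rewrite scale0r add0r.
  have [->|_] := eqVneq k l; last by rewrite scale0r !scaler0 mul0r.
  rewrite -{1}[U_(_)%MM]add0m addmK mpolyX0 mul1r scale1r scalerA.
  by rewrite -mul_mpolyC mulr1.
have Xr k : (tnth zsubst_tuple (rshift M k))^`M(rshift M l) =
    (- ((k == l)%:R * (r * i)))%:MP.
  rewrite zsubst_tupler mderivZ mderivB mderivZ !mderivX !mnm1E eq_rshift eq_lrshift.
  rewrite scale0r sub0r.
  have [->|_] := eqVneq k l; last by rewrite scale0r scaler0 oppr0 scaler0 mul0r oppr0.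
  rewrite -{1}[U_(_)%MM]add0m addmK mpolyX0 mul1r scale1r scalerN scalerA.
  by rewrite -mul_mpolyC mulr1 mpolyCN.
rewrite [LHS]mderiv_comp big_split_ord /= (bigD1 l) //= big1 => [|k kl]; last first.
  by rewrite Xl (negPf kl) mul0r mulr0.
rewrite (bigD1 l) //= big1 => [|k kl]; last first.
  by rewrite Xr (negPf kl) mul0r oppr0 mulr0.
rewrite Xl Xr eqxx mul1r !addr0 mpolyCN mulrN -mulrBl [LHS]mulrC mul_mpolyC.
congr (_ *: _).
by rewrite /zsubst linearB.
Qed.

(** The complex coordinates are canonical up to the factor [- i], which yields {z_l, conj z_l} = i.
    By the Wirtinger relations each summand acquires the factor 2 r^2 i, and 2 r^2 = 1. *)
Lemma canonical_bracket_zsubst f g :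
  br (zsubst f) (zsubst g) = - i *: zsubst (br f g).
Proof.
rewrite /canonical_bracket [zsubst (\sum_l _)]raddf_sum scaler_sumr.
apply: eq_bigr => l _ /=.
rewrite (mderiv_zsubstl l f) (mderiv_zsubstl l g).
rewrite (mderiv_zsubstr l f) (mderiv_zsubstr l g).
have zB u v : zsubst (u - v) = zsubst u - zsubst v := rmorphB zsubst u v.
have zD u v : zsubst (u + v) = zsubst u + zsubst v := rmorphD zsubst u v.
have zM u v : zsubst (u * v) = zsubst u * zsubst v := rmorphM zsubst u v.
rewrite !(zB, zD, zM).
set a := zsubst (Q l f); set b := zsubst (P l f).
set c := zsubst (Q l g); set d := zsubst (P l g).
rewrite -!scalerAl -!scalerAr !scalerA.
rewrite (_ : r * i * r = i * (r * r)); last by ring.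
rewrite (_ : r * (r * i) = i * (r * r)); last by ring.
rewrite -scalerBr (_ : _ - _ = (a * d - b * c) *+ 2); last by ring.
by rewrite -scaler_nat scalerA -mulrA rr mulr1 scaleNr -scalerN opprB.
Qed.

Lemma canonical_bracket_X (m k : 'X_{1..M + M}) :
  br 'X_[m] 'X_[k] = \sum_l
    ((m (rshift M l) * k (lshift M l))%:R - (m (lshift M l) * k (rshift M l))%:R)
      *: 'X_[m + k - mnm_I l].
Proof.
apply: eq_bigr => l _; rewrite /P /Q /= !mderivX.
rewrite -!scalerAl -!scalerAr !scalerA -!natrM -!mpolyXD scalerBl; congr (_ - _).
  (* Subtraction of exponents is truncated. The exponents on the two sides agree when both factors
     of the coefficient are positive; otherwise the coefficient is zero. *)
  have [e|] := posnP (m (rshift M l) * k (lshift M l)).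
    by rewrite e !scale0r.
  rewrite muln_gt0 => /andP[m1 k1]; congr (_ *: mpolyX _ _).
  apply: mnm_pairP => j; rewrite !(mnmDE, mnmBE) ?mnm_I_l ?mnm_I_r !mnm1E
    ?eq_lshift ?eq_rshift ?eq_lrshift ?eq_rlshift;
  by case: (eqVneq l j) => [<-|_] /=; lia.
have [e|] := posnP (m (lshift M l) * k (rshift M l)).
  by rewrite e !scale0r.
rewrite muln_gt0 => /andP[m1 k1]; congr (_ *: mpolyX _ _).
apply: mnm_pairP => j; rewrite !(mnmDE, mnmBE) ?mnm_I_l ?mnm_I_r !mnm1E
    ?eq_lshift ?eq_rshift ?eq_lrshift ?eq_rlshift;
  by case: (eqVneq l j) => [<-|_] /=; lia.
Qed.

Implicit Types m : 'X_{1..M + M}.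

(** The monomials z^x conj(z)^y written in q and p. They form a basis of the polynomials, and
    [zcoef] below gives the coordinates in it. *)
Definition zmon m : poly := zsubst 'X_[m].
Definition zcoef m f : K := (zsubst_inv f)@_m.

Lemma zmonD m m' : zmon (m + m')%MM = zmon m * zmon m'.
Proof. by rewrite /zmon mpolyXD rmorphM. Qed.

Lemma zmon0 : zmon 0%MM = 1.
Proof. by rewrite /zmon mpolyX0 rmorph1. Qed.

Lemma zcoef_zmon m m' : zcoef m (zmon m') = (m' == m)%:R.
Proof. by rewrite /zcoef /zmon zsubstK mcoeffX. Qed.

Lemma zcoefP c f g m : zcoef m (c *: f + g) = c * zcoef m f + zcoef m g.
Proof. by rewrite /zcoef linearP /= mcoeffD mcoeffZ. Qed.

Lemma zmonE f : f = \sum_(m <- msupp (zsubst_inv f)) zcoef m f *: zmon m.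
Proof.
rewrite -{1}(zsubst_invK f) {1}(mpolyE (zsubst_inv f)) raddf_sum /=.
by apply: eq_bigr => m _; rewrite linearZ_LR.
Qed.

Lemma zcoef0 m : zcoef m 0 = 0.
Proof. by rewrite /zcoef raddf0 mcoeff0. Qed.

Lemma zmon_inj : injective zmon.
Proof.
move=> m m' e; have := congr1 (zcoef m') e; rewrite !zcoef_zmon eqxx.
by case: eqP => // _ /eqP; rewrite eq_sym oner_eq0.
Qed.

Lemma zmon_mulm m d : zmon (m *+ d)%MM = zmon m ^+ d.
Proof. by elim: d => [|d IH]; rewrite ?zmon0 // mulmS zmonD IH exprS. Qed.

Lemma zmon_sum (J : Type) (s : seq J) (F : J -> 'X_{1..M + M}) :
  zmon (\sum_(x <- s) F x)%MM = \prod_(x <- s) zmon (F x).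
Proof. exact: (big_morph zmon zmonD zmon0). Qed.

Lemma zmon_pair (x y : 'I_M -> nat) : zmon (mnm_pair x y) =
  \prod_l (zmon U_(lshift M l) ^+ x l * zmon U_(rshift M l) ^+ y l).
Proof.
have -> : mnm_pair x y =
    (\sum_l (U_(lshift M l) *+ x l + U_(rshift M l) *+ y l))%MM.
  apply: mnm_pairP => j; rewrite mnm_pairE mnm_sumE (bigD1 j) //= big1.
  - by rewrite mnmDE !mulmnE !mnm1E eqxx eq_rlshift; lia.
  - by move=> l /negPf lj; rewrite mnmDE !mulmnE !mnm1E eq_lshift lj eq_rlshift.
  - by rewrite mnmDE !mulmnE !mnm1E eqxx eq_lrshift; lia.
  - by move=> l /negPf lj; rewrite mnmDE !mulmnE !mnm1E eq_rshift lj eq_lrshift.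
by rewrite zmon_sum; apply: eq_bigr => l _; rewrite zmonD !zmon_mulm.
Qed.

Lemma canonical_bracket_zmon m m' : br (zmon m) (zmon m') = i *: \sum_l
    ((m (lshift M l) * m' (rshift M l))%:R - (m (rshift M l) * m' (lshift M l))%:R)
      *: zmon (m + m' - mnm_I l).
Proof.
rewrite canonical_bracket_zsubst canonical_bracket_X scaleNr [zsubst _]raddf_sum /=.
rewrite -scalerN -sumrN; congr (_ *: _); apply: eq_bigr => l _.
by rewrite linearZ_LR -scaleNr opprB.
Qed.

(** Only the summand at l survives, and there [mnm_I l] is added and removed again, so bracketing
    with |z_l|^2 is diagonal on monomials. *)
Lemma canonical_bracket_zmon_I m l : br (zmon m) (zmon (mnm_I l)) =
  (i * ((m (lshift M l))%:R - (m (rshift M l))%:R)) *: zmon m.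
Proof.
rewrite canonical_bracket_zmon (bigD1 l) //= big1 => [|j /negPf jl]; last first.
  by rewrite mnm_I_l mnm_I_r eq_sym jl !muln0 subrr scale0r.
by rewrite mnm_I_l mnm_I_r eqxx !muln1 addr0 addmK scalerA.
Qed.

End ComplexCoordinates.

(** * Generators and dimension *)

Section GeneratedAlgebra.
Variables (K : numClosedFieldType) (A : comAlgType K).
Implicit Types (s : seq A) (f g : A).

Definition poly_expr s f : Prop :=
  exists P : {mpoly K[size s]}, f = mmap (in_alg A) (fun i => s`_i) P.

Lemma poly_exprP s c f g : poly_expr s f -> poly_expr s g -> poly_expr s (c *: f + g).
Proof.
move=> [P ->] [Q ->]; exists (c *: P + Q).
by rewrite mmapD mmapZ /= mulr_algl.
Qed.

Lemma poly_expr1 s : poly_expr s 1.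
Proof. by exists 1; rewrite rmorph1. Qed.

Lemma poly_exprM s f g : poly_expr s f -> poly_expr s g -> poly_expr s (f * g).
Proof. by move=> [P ->] [Q ->]; exists (P * Q); rewrite rmorphM. Qed.

Lemma poly_expr_mem s f : f \in s -> poly_expr s f.
Proof.
move=> fs; exists 'X_(Ordinal (etrans (index_mem f s) fs)).
by rewrite mmapX mmap1U /= nth_index.
Qed.

Lemma poly_expr_ind s (P : A -> Prop) :
  (forall c f g, P f -> P g -> P (c *: f + g)) -> P 1 ->
  (forall f g, P f -> P g -> P (f * g)) -> (forall f, f \in s -> P f) ->
  forall f, poly_expr s f -> P f.
Proof.
move=> PP P1 PM Ps f [p ->]; elim/mpoly_alg_ind: p => [c p q Pp Pq||p q Pp Pq|i].
- by rewrite mmapD mmapZ /= mulr_algl; apply: PP.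
- by rewrite rmorph1.
- by rewrite rmorphM; apply: PM.
- by rewrite mmapX mmap1U; apply: Ps; apply: mem_nth.
Qed.

(* The D w are the coordinates of a derivation at the point eps: on polynomial
   expressions in s they only see the linear terms, hence span a space of
   dimension at most size s. *)
Lemma generates_size_ge (F : {pred A}) (N : nat) (eps : A -> K)
    (D : 'I_N -> A -> K) (e : 'I_N -> A) s :
  (forall w c f g, D w (c *: f + g) = c * D w f + D w g) ->
  (forall w, D w 1 = 0) ->
  (forall w, {in F &, forall f g, D w (f * g) = eps f * D w g + eps g * D w f}) ->
  (forall v w, D w (e v) = (v == w)%:R) -> (forall v, e v \in F) ->
  generates F s -> (N <= size s)%N.
Proof.
move=> DP D1 DM De eF gen.
pose S := \matrix_(i < size s, w < N) D w s`_i.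
have D0 w : D w 0 = 0.
  by have := DP w (-1) 1 1; rewrite scaleN1r addNr !D1 mulr0 addr0.
have exprP f : poly_expr s f -> (\row_w D w f <= S)%MS.
  move=> sf; suff [] : poly_expr s f /\ (\row_w D w f <= S)%MS by [].
  move: f sf; apply: poly_expr_ind => [c f g [sf Sf] [sg Sg]||f g [sf Sf] [sg Sg]|f fs].
  - split; first exact: poly_exprP.
    have -> : \row_w D w (c *: f + g) = c *: (\row_w D w f) + \row_w D w g.
      by apply/rowP => w; rewrite !mxE DP.
    by rewrite addmx_sub ?scalemx_sub.
  - split; first exact: poly_expr1.
    have -> : \row_w D w (1 : A) = 0 by apply/rowP => w; rewrite !mxE D1.
    exact: sub0mx.
  - split; first exact: poly_exprM.
    have -> : \row_w D w (f * g) = eps f *: (\row_w D w g) + eps g *: (\row_w D w f).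
      by apply/rowP => w; rewrite !mxE DM //; apply/gen.
    by rewrite addmx_sub ?scalemx_sub.
  - split; first exact: poly_expr_mem.
    have fi : (index f s < size s)%N by rewrite index_mem.
    have -> : \row_w D w f = row (Ordinal fi) S.
      by apply/rowP => w; rewrite !mxE /= nth_index.
    exact: row_sub.
(* The rows of the identity matrix are the values of the D w on the e v, so S has rank at least N
   while it has only [size s] rows. *)
have : (1%:M <= S)%MS.
  apply/row_subP => v; have := exprP _ (proj1 (gen _) (eF v)).
  by congr (is_true (_ <= _)%MS); apply/rowP => w; rewrite !mxE De.
by move/mxrankS; rewrite mxrank1 => /leq_trans; apply; apply: rank_leq_row.
Qed.

End GeneratedAlgebra.

(** * The kernel of the bracket with the oscillator *)

Section ResonantSubalgebra.
Variables (K : numClosedFieldType) (M : nat) (r i : K).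
Hypotheses (rr : r * r * 2 = 1) (ii : i * i = -1).
Variable n : 'I_M -> nat.
Local Notation poly := {mpoly K[M + M]}.
Implicit Types (f g : poly) (l : 'I_M) (m : 'X_{1..M + M}).
Let P l : {linear poly -> poly} := mderiv (rshift M l).
Let Q l : {linear poly -> poly} := mderiv (lshift M l).
Local Notation br := (canonical_bracket P Q).
Local Notation zmon := (zmon r i).
Local Notation zcoef := (zcoef r i).

(** This is H_0 in complex coordinates, as [H0_oscillator] confirms. *)
Definition oscillator : poly := \sum_l (n l)%:R *: zmon (mnm_I l).

Let eigen m : K := (\sum_l n l * m (lshift M l))%:R - (\sum_l n l * m (rshift M l))%:R.

Lemma bracket_zmon_oscillator m : br (zmon m) oscillator = (i * eigen m) *: zmon m.
Proof.
rewrite canonical_bracketC (canonical_bracket_suml P Q) -sumrN.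
rewrite (eq_bigr (fun l => (i * ((n l * m (lshift M l))%:R - (n l * m (rshift M l))%:R))
   *: zmon m)); last first.
  move=> l _; rewrite -scalerN -canonical_bracketC.
  rewrite (canonical_bracket_zmon_I i rr) scalerA !natrM -mulrBr mulrCA.
  by [].
by rewrite -scaler_suml -mulr_sumr sumrB -!natr_sum.
Qed.

Lemma eigen_eq0 m : (eigen m == 0) = mnm_res n m.
Proof. by rewrite subr_eq0 eqr_nat. Qed.

Lemma bracket_res_zmon m : mnm_res n m -> br (zmon m) oscillator = 0.
Proof.
by rewrite -eigen_eq0 bracket_zmon_oscillator => /eqP ->; rewrite mulr0 scale0r.
Qed.

Lemma zcoef_bracket m f : zcoef m (br f oscillator) = i * eigen m * zcoef m f.
Proof.
rewrite (zmonE rr ii f).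
pose T g := zcoef m (br g oscillator) = i * eigen m * zcoef m g.
apply: (big_rec T) => [|k g _ IH].
  by rewrite /T canonical_bracket0 zcoef0 mulr0.
rewrite /T in IH *.
rewrite canonical_bracketDl !zcoefP IH [RHS]mulrDr; congr (_ + _).
rewrite bracket_zmon_oscillator -[_ *: zmon k]addr0 zcoefP zcoef0 addr0.
rewrite (zcoef_zmon rr ii).
by case: eqP => [->|_]; rewrite ?mulr1 ?mulr0 // mulrC.
Qed.

(** Bracketing with the oscillator multiplies the coefficient at m by [i * eigen m]. For f in the
    kernel, a nonzero coefficient forces [eigen m = 0], as i is nonzero, so f is a combination of
    resonant monomials. *)
Lemma res_ind (T : poly -> Prop) :
  T 0 -> (forall c f g, T f -> T g -> T (c *: f + g)) ->
  (forall m, mnm_res n m -> T (zmon m)) ->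
  forall f, br f oscillator = 0 -> T f.
Proof.
move=> T0 TP Tz f f0; rewrite (zmonE rr ii f).
apply: (big_rec T) => // m g _ Tg.
have [e|e] := eqVneq (zcoef m f) 0; first by rewrite e scale0r add0r.
apply: TP => //; apply: Tz; rewrite -eigen_eq0.
have := zcoef_bracket m f; rewrite f0.
rewrite zcoef0 => /esym/eqP; rewrite !mulf_eq0 (negPf e) orbF => /orP[/eqP i0|//].
by move: ii; rewrite i0 mul0r => /eqP; rewrite eq_sym oppr_eq0 oner_eq0.
Qed.

(** By bilinearity and [res_ind] it suffices to take f and g to be resonant monomials with exponents
    k and k'. Irreducibility allows k + k' = m only when one of them is 0, and these two cases are
    the two terms on the right. *)
Lemma zcoef_irrM m f g : mnm_irr n m ->
  br f oscillator = 0 -> br g oscillator = 0 ->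
  zcoef m (f * g) = zcoef 0%MM f * zcoef m g + zcoef 0%MM g * zcoef m f.
Proof.
move=> [m0 mr mirr] f0 g0.
move: f f0; apply: res_ind => [|c f f' IH IH'|k kr].
- by rewrite mul0r !zcoef0 mul0r mulr0 addr0.
- by rewrite mulrDl -scalerAl !zcoefP IH IH'; ring.
move: g g0; apply: res_ind => [|c f f' IH IH'|k' kr'].
- by rewrite mulr0 !zcoef0 mul0r mulr0 addr0.
- by rewrite mulrDr -scalerAr !zcoefP IH IH'; ring.
rewrite -zmonD !(zcoef_zmon rr ii) -!natrM -natrD; congr _%:R.
have [k0|k0] := eqVneq k 0%MM.
  rewrite k0 add0m mul1n [0%MM == m]eq_sym (negPf m0) muln0 addn0.
  by case: eqP.
have [k0'|k0'] := eqVneq k' 0%MM; first by rewrite k0' addm0 mul1n.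
rewrite !mul0n; case: eqP => // e.
by case: (mirr k k' kr kr' (esym e)) => e0; rewrite e0 eqxx in k0 k0'.
Qed.

End ResonantSubalgebra.

Lemma circ_addE (M : nat) (a b : Zvec M) l : circ_add a b l =
  minn (pospart a l + pospart b l) (negpart a l + negpart b l).
Proof. exact: ffunE. Qed.

(** * Existence of the expansions defining the multiplicities mu *)

Section Expansion.
Variables (M : nat) (n : 'I_M -> nat) (Gamma : seq (Zvec M)).
Hypotheses (Gamma_uniq : uniq Gamma)
  (GammaP : forall a, a \in Gamma <-> minimal_solution n a).
Implicit Types (a b c : Zvec M).

(** Passes from a decomposition with repeated summands to multiplicities indexed by [Gamma]. *)
Lemma sum_count_mem (T : eqType) (s t : seq T) (f : T -> nat) :
  uniq s -> {subset t <= s} ->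
  (\sum_(x <- t) f x = \sum_(x <- s) f x * count_mem x t)%N.
Proof.
move=> us; elim: t => [|y t IH] ts.
  by rewrite big_nil big1 // => x _; rewrite muln0.
rewrite big_cons IH => [|x xt]; last by apply: ts; rewrite inE xt orbT.
under [RHS]eq_bigr do rewrite /= mulnDr.
rewrite big_split /=; congr (_ + _)%N.
have ys : y \in s by apply: ts; rewrite mem_head.
rewrite (bigD1_seq y) //= eqxx muln1 big1 ?addn0 // => x /negPf xy.
by rewrite eq_sym xy muln0.
Qed.

Lemma mnm_vec_res a : a \in Gamma -> mnm_res n (mnm_vec a).
Proof. by move/GammaP/minimal_solutionP => -[]. Qed.

Lemma mnm_pair_diag_res (x : 'I_M -> nat) : mnm_res n (mnm_pair x x).
Proof. by apply/eqP; apply: eq_bigr => l _; rewrite !mnm_pairE. Qed.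

(** Removing the componentwise minimum from both halves leaves a resonant exponent whose halves have
    disjoint supports. No [mnm_I l] can occur among its irreducible summands, so all of them come
    from [Gamma], and mu counts them. *)
Lemma circ_expansion a b : a \in Gamma -> b \in Gamma ->
  exists mu : Zvec M -> nat,
    (mnm_vec a + mnm_vec b =
     \sum_(c <- Gamma) mnm_vec c *+ mu c + mnm_pair (circ_add a b) (circ_add a b))%MM.
Proof.
move=> aG bG; set o := mnm_pair (circ_add a b) _.
have e : (mnm_vec a + mnm_vec b = o + (mnm_vec a + mnm_vec b - o))%MM.
  apply: mnm_pairP => l; rewrite [RHS]mnmDE mnmBE mnmDE /o !mnm_pairE circ_addE; lia.
set m := (_ - o)%MM in e.
have mr : mnm_res n m.
  have := mnm_resDr (mnm_vec b) (mnm_vec_res aG).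
  by rewrite mnm_vec_res // e mnm_resDr // mnm_pair_diag_res.
have [s sirr sE] := mnm_res_decomp mr.
have m_min l : minn (m (lshift M l)) (m (rshift M l)) = 0%N.
  rewrite !mnmBE !mnmDE /o !mnm_pairE circ_addE; lia.
have sG k : k \in s -> exists2 c, c \in Gamma & k = mnm_vec c.
  move=> ks; case: (mnm_irr_cases (sirr k ks)) => [[l kE]|[c /GammaP cG kE]];
    last by exists c.
  have le j : (k j <= m j)%N by rewrite sE mnm_sumE (big_rem k) //= leq_addr.
  have := m_min l; have := le (lshift M l); have := le (rshift M l).
  by rewrite kE mnm_I_l mnm_I_r eqxx; lia.
have [t tG tE] : exists2 t, {subset t <= Gamma} & s = map (@mnm_vec M) t.
  elim: s sG {sirr sE} => [|k s IH] sG; first by exists [::].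
  have [c cG kE] := sG k (mem_head _ _).
  have [k' k's|t tG ->] := IH; first by apply: sG; rewrite inE k's orbT.
  exists (c :: t); last by rewrite /= kE.
  by move=> x; rewrite inE => /predU1P[->|/tG].
exists (fun c => count_mem c t); rewrite e addmC; congr (_ + _)%MM.
apply/mnmP => j; rewrite sE tE big_map !mnm_sumE (sum_count_mem _ Gamma_uniq tG).
by apply: eq_bigr => c _; rewrite mulmnE.
Qed.

Lemma is_expansionP (mu : Zvec M -> Zvec M -> Zvec M -> nat) :
  is_expansion Gamma mu <-> forall a b, a \in Gamma -> b \in Gamma ->
    (mnm_vec a + mnm_vec b = \sum_(c <- Gamma) mnm_vec c *+ mu a b c
      + mnm_pair (circ_add a b) (circ_add a b))%MM.
Proof.
have ffun_sum (F : Zvec M -> Nvec M) (w : Zvec M -> nat) l :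
    (\sum_(c <- Gamma) F c *+ w c) l = (\sum_(c <- Gamma) F c l * w c)%N.
  elim/big_rec2: _ => [|c x y _ IH]; first by rewrite ffunE.
  rewrite ffunE IH; congr (_ + _)%N.
  by elim: (w c) => [|d IHd]; rewrite ?mulr0n ?muln0 ?ffunE // mulrS ffunE IHd mulnS.
have addE (x y : Nvec M) l : (x + y) l = (x l + y l)%N by rewrite ffunE.
split=> mu_exp a b aG bG.
  have [/ffunP ep /ffunP em] := mu_exp a b aG bG.
  apply: mnm_pairP => l; rewrite !mnmDE mnm_sumE !mnm_pairE.
    have := ep l; rewrite !addE ffun_sum => ->.
    by congr (_ + _)%N; apply: eq_bigr => c _; rewrite mulmnE mnm_pairE.
  have := em l; rewrite !addE ffun_sum => ->.
  by congr (_ + _)%N; apply: eq_bigr => c _; rewrite mulmnE mnm_pairE.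
have /mnmP e := mu_exp a b aG bG.
split; apply/ffunP => l; rewrite !addE ffun_sum.
  have := e (lshift M l); rewrite !mnmDE mnm_sumE !mnm_pairE => ->.
  by congr (_ + _)%N; apply: eq_bigr => c _; rewrite mulmnE mnm_pairE.
have := e (rshift M l); rewrite !mnmDE mnm_sumE !mnm_pairE => ->.
by congr (_ + _)%N; apply: eq_bigr => c _; rewrite mulmnE mnm_pairE.
Qed.

Lemma expansion_exists :
  exists mu : Zvec M -> Zvec M -> Zvec M -> nat, is_expansion Gamma mu.
Proof.
have ex (ab : Zvec M * Zvec M) : exists mu : Zvec M -> nat,
    ab.1 \in Gamma -> ab.2 \in Gamma -> (mnm_vec ab.1 + mnm_vec ab.2 =
     \sum_(c <- Gamma) mnm_vec c *+ mu c
       + mnm_pair (circ_add ab.1 ab.2) (circ_add ab.1 ab.2))%MM.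
  (* Choice needs a value for every pair; outside [Gamma] nothing is required, and 0 is taken. *)
  case: (boolP (ab.1 \in Gamma)) => [aG|_]; last by exists (fun=> 0%N).
  case: (boolP (ab.2 \in Gamma)) => [bG|_]; last by exists (fun=> 0%N).
  by have [mu muE] := circ_expansion aG bG; exists mu.
have [mu muE] := boolp.choice ex.
by exists (fun a b => mu (a, b)); apply/is_expansionP => a b; apply: (muE (a, b)).
Qed.

End Expansion.

(** * The structure polynomials of the bracket *)

Section PhiPolynomial.
Variables (M : nat) (a b : Zvec M).

Let circ_mnm : 'X_{1..M} := [multinom circ_add a b l | l < M].

(** The division by lambda_l is absorbed into the exponent. The truncated subtraction of [U_(l)] is
    genuine wherever the coefficient is nonzero, by [zbracket_circ_gt0]. *)
Definition Phi_circ : {mpoly int[M]} :=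
  \sum_l zbracket a b l *: 'X_[circ_mnm - U_(l)].

(** If the minimum vanishes at l, then either a_+ and b_+ or a_- and b_- are both zero there. Each
    product in the bracket contains one factor of each sign, so both products vanish. *)
Lemma zbracket_circ_gt0 l : zbracket a b l != 0 -> (0 < circ_add a b l)%N.
Proof.
rewrite circ_addE [zbracket a b l]ffunE subr_eq0 eqz_nat leq_min !addn_gt0.
by case: (pospart a l) (negpart b l) (negpart a l) (pospart b l)
  => [|p] [|q] [|s] [|t] //; rewrite ?mul0n ?muln0 ?eqxx.
Qed.

Lemma mmap_Phi_circ (S : comNzRingType) (h : 'I_M -> S) :
  mmap intr h Phi_circ = \sum_l (zbracket a b l)%:~R *
    \prod_k h k ^+ (circ_add a b k - (l == k))%N.
Proof.
rewrite raddf_sum /=; apply: eq_bigr => l _; rewrite mmapZ mmapX; congr (_ * _).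
by apply: eq_bigr => k _; rewrite mnmBE mnmE mnm1E.
Qed.

Lemma mmap_Phi_circE (K : fieldType) (lambda : 'I_M -> K) :
  (forall l, lambda l != 0) -> mmap intr lambda Phi_circ = PhiCirc a b lambda.
Proof.
move=> l0; rewrite mmap_Phi_circ /PhiCirc mulr_sumr; apply: eq_bigr => l _.
have [->|/zbracket_circ_gt0 c0] := eqVneq (zbracket a b l) 0.
  by rewrite !mul0r mulr0.
rewrite (bigD1 l) //= [X in _ = X * _](bigD1 l) //= eqxx.
have -> : \prod_(k < M | k != l) lambda k ^+ (circ_add a b k - (l == k)) =
          \prod_(k < M | k != l) lambda k ^+ circ_add a b k.
  by apply: eq_bigr => k /negPf kl; rewrite eq_sym kl subn0.
rewrite -{2}(prednK c0) exprS subn1.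
by field.
Qed.

End PhiPolynomial.

(** [G] stands for the exponent of the product over [Gamma]. In the l-th summand the factor |z_l|^2
    is taken out of the power of the A_I, which is possible because its exponent is positive when
    the coefficient is nonzero. *)
Lemma bracket_zmon_vec (K : comNzRingType) (M : nat) (r i : K)
    (rr : r * r * 2 = 1) (a b : Zvec M) (G : 'X_{1..M + M}) :
  (mnm_vec a + mnm_vec b = G + mnm_pair (circ_add a b) (circ_add a b))%MM ->
  canonical_bracket (fun l => mderiv (rshift M l)) (fun l => mderiv (lshift M l))
      (zmon r i (mnm_vec a)) (zmon r i (mnm_vec b)) =
    i *: (mmap intr (fun l => zmon r i (mnm_I l)) (Phi_circ a b) * zmon r i G).
Proof.
move=> e; rewrite (canonical_bracket_zmon i rr) mmap_Phi_circ mulr_suml.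
congr (_ *: _); apply: eq_bigr => l _; rewrite !mnm_pairE.
have -> : (pospart a l * negpart b l)%:R - (negpart a l * pospart b l)%:R =
    (zbracket a b l)%:~R :> K.
  by rewrite [zbracket a b l]ffunE rmorphB.
have [->|z0] := eqVneq (zbracket a b l) 0; first by rewrite !mulr0z scale0r !mul0r.
have c0 := zbracket_circ_gt0 z0.
rewrite scaler_int -mulrA mulrzl; congr (_ *~ _).
pose x k := (circ_add a b k - (l == k))%N.
have -> : \prod_k zmon r i (mnm_I k) ^+ (circ_add a b k - (l == k)) =
    zmon r i (mnm_pair x x).
  by rewrite zmon_pair; apply: eq_bigr => k _; rewrite zmonD exprMn.
rewrite -zmonD; congr (zmon r i _); rewrite e.
by apply: mnm_pairP => k; rewrite [RHS]mnmDE mnmBE mnmDE !mnm_pairE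
    ?mnm_I_l ?mnm_I_r /x;
  have [<-|_] := eqVneq l k; lia.
Qed.

(** * Generation by the irreducible monomials and minimality of their number *)

Section ResonantGenerators.
Variables (K : numClosedFieldType) (M : nat) (r i : K).
Hypotheses (rr : r * r * 2 = 1) (ii : i * i = -1).
Variable n : 'I_M -> nat.
Hypothesis n_gt0 : forall l, (0 < n l)%N.
Variable Gamma : seq (Zvec M).
Hypotheses (Gamma_uniq : uniq Gamma)
  (GammaP : forall a, a \in Gamma <-> minimal_solution n a).
Local Notation poly := {mpoly K[M + M]}.
Implicit Types (f g : poly) (l : 'I_M) (m : 'X_{1..M + M}) (a b : Zvec M).
Let P l : {linear poly -> poly} := mderiv (rshift M l).
Let Q l : {linear poly -> poly} := mderiv (lshift M l).
Local Notation br := (canonical_bracket P Q).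
Local Notation zmon := (zmon r i).
Local Notation zcoef := (zcoef r i).
Local Notation osc := (oscillator r i n).

Definition irr_seq : seq 'X_{1..M + M} :=
  map (@mnm_vec M) Gamma ++ map (@mnm_I M) (enum 'I_M).

Lemma irr_seqP m : m \in irr_seq <-> mnm_irr n m.
Proof.
rewrite mem_cat; split=> [/orP[]/mapP[x xs ->]|].
- by apply/minimal_solutionP/GammaP.
- exact: mnm_irr_I.
case/mnm_irr_cases => [[l ->]|[a /GammaP aG ->]]; apply/orP; [right|left].
  by apply: map_f; rewrite mem_enum.
exact: map_f.
Qed.

Lemma irr_seq_uniq : uniq irr_seq.
Proof.
rewrite cat_uniq (map_inj_uniq (@mnm_vec_inj M)) (map_inj_uniq (@mnm_I_inj M)).
rewrite enum_uniq Gamma_uniq andbT /=.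
apply/hasPn => _ /mapP[l _ ->]; apply/mapP => -[a _ e].
by have := mnm_vec_I a l; rewrite e eqxx.
Qed.

Lemma size_irr_seq : size irr_seq = (size Gamma + M)%N.
Proof. by rewrite /irr_seq size_cat 2!size_map size_enum_ord. Qed.

Lemma bracket_mul0 f g : br f osc = 0 -> br g osc = 0 -> br (f * g) osc = 0.
Proof.
move=> f0 g0; have PM l u v : P l (u * v) = P l u * v + u * P l v := mderivM _ u v.
have QM l u v : Q l (u * v) = Q l u * v + u * Q l v := mderivM _ u v.
rewrite canonical_bracketC (canonical_bracketM PM QM).
rewrite canonical_bracketC f0 oppr0 mul0r add0r.
by rewrite canonical_bracketC g0 oppr0 mulr0 oppr0.
Qed.

Lemma bracket_lin0 c f g : br f osc = 0 -> br g osc = 0 -> br (c *: f + g) osc = 0.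
Proof. by move=> f0 g0; rewrite canonical_bracketDl f0 g0 scaler0 addr0. Qed.

Lemma bracket_one0 : br 1 osc = 0.
Proof. by rewrite -(zmon0 M r i) (bracket_res_zmon _ rr) // mnm_res0. Qed.

(** [zmon] turns the decomposition of a resonant exponent into irreducibles into a product of
    generators. *)
Lemma poly_expr_zmon m : mnm_res n m -> poly_expr (map zmon irr_seq) (zmon m).
Proof.
case/mnm_res_decomp => s sirr ->; rewrite zmon_sum big_seq.
apply: big_ind => [|f g|k ks]; first exact: poly_expr1.
- exact: poly_exprM.
- by apply: poly_expr_mem; apply: map_f; apply/irr_seqP/sirr.
Qed.

Lemma generates_irr (F : {pred poly}) : (forall f, f \in F <-> br f osc = 0) ->
  generates F (map zmon irr_seq).
Proof.
move=> FP f; rewrite FP; split.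
  apply: (res_ind rr ii (T := poly_expr (map zmon irr_seq))).
  - have := poly_exprP (-1) (poly_expr1 (map zmon irr_seq)) (poly_expr1 _).
    by rewrite scaleN1r addNr.
  - by move=> c u v; apply: poly_exprP.
  - exact: poly_expr_zmon.
move: f; apply: poly_expr_ind => [c f g||f g|_ /mapP[m /irr_seqP[_ mr _] ->]].
- exact: bracket_lin0.
- exact: bracket_one0.
- exact: bracket_mul0.
- exact: (bracket_res_zmon _ rr).
Qed.

Lemma functional_dimension_irr (F : {pred poly}) :
  (forall f, f \in F <-> br f osc = 0) ->
  functional_dimension F (size Gamma + M).
Proof.
move=> FP; split.
  exists (map zmon irr_seq); first by rewrite size_map size_irr_seq.
  exact: generates_irr.
rewrite -size_irr_seq => s gen.
pose W (w : 'I_(size irr_seq)) := nth 0%MM irr_seq w.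
have Wirr w : mnm_irr n (W w) by apply/irr_seqP; apply: mem_nth.
(* The derivations are the coefficients at the irreducible exponents, taken at the point given by
   the constant coefficient; the irreducible monomials are dual to them. *)
apply: (@generates_size_ge _ _ F _ (zcoef 0%MM) (fun w => zcoef (W w))
  (fun w => zmon (W w)) s) => //.
- by move=> w c f g; apply: zcoefP.
- move=> w; rewrite -(zmon0 M r i) (zcoef_zmon rr ii).
  by have [/negPf w0 _ _] := Wirr w; rewrite eq_sym w0.
- by move=> w f g /FP f0 /FP g0; apply: (zcoef_irrM rr ii (Wirr w)).
- move=> v w; rewrite (zcoef_zmon rr ii) /W nth_uniq ?irr_seq_uniq //.
- by move=> v; apply/FP; apply: (bracket_res_zmon _ rr); case: (Wirr v).
Qed.

End ResonantGenerators.

Section ComplexCoordinatesQuadratic.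
Variables (K : comNzRingType) (M : nat) (r i : K).
Hypothesis (ii : i * i = -1).

Lemma zmon_I_quadratic (l : 'I_M) : zmon r i (mnm_I l) =
  (r * r) *: ('X_(lshift M l) ^+ 2 + 'X_(rshift M l) ^+ 2).
Proof.
rewrite zmonD /zmon zsubst_Xl zsubst_Xr -scalerAl -scalerAr scalerA.
congr (_ *: _); rewrite mulrC -subr_sqr exprZn [i ^+ 2]expr2 ii scaleN1r opprK.
by [].
Qed.

End ComplexCoordinatesQuadratic.

(** * The oscillator on R^(2M) *)

Section ConcreteOscillator.
Variables (R : realType) (M : nat).
Let C : numClosedFieldType := R[i].
Local Notation poly := (polyfun R M).
Implicit Types (f g h : poly) (l : 'I_M) (m : 'X_{1..M + M}) (a b : Zvec M).
Local Notation br := (@pbracket R M).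

Definition inv_sqrt2 : C := (Num.sqrt (2 : R))^-1%:C%C.
Definition imag : C := @iC R.

Lemma inv_sqrt2_sqr : inv_sqrt2 * inv_sqrt2 * 2 = 1.
Proof.
have e : (Num.sqrt (2 : R))^-1 * (Num.sqrt (2 : R))^-1 * 2 = 1.
  by rewrite -invfM -expr2 sqr_sqrtr // mulVf // pnatr_eq0.
have := congr1 (real_complex R) e; rewrite !rmorphM /= rmorph1.
by rewrite rmorph_nat.
Qed.

Lemma imag_sqr : imag * imag = -1.
Proof. by rewrite -expr2; exact: sqrCi. Qed.

Lemma conj_inv_sqrt2 : Num.conj inv_sqrt2 = inv_sqrt2.
Proof. exact: conjc_real. Qed.

Definition czmon m : poly := zmon inv_sqrt2 imag m.

Lemma czmonD m m' : czmon (m + m')%MM = czmon m * czmon m'.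
Proof. exact: zmonD. Qed.

Lemma czmon_inj : injective czmon.
Proof. exact: (zmon_inj inv_sqrt2_sqr imag_sqr). Qed.

Lemma czmon_q l : czmon U_(lshift M l) = zX R l.
Proof. exact: zsubst_Xl. Qed.

Lemma pconj_zX l : pconj (zX R l) = inv_sqrt2 *: (qX R l - imag *: pX R l).
Proof.
rewrite /zX /pconj map_mpolyZ raddfD /= map_mpolyZ !map_mpolyX.
by rewrite conj_inv_sqrt2 /= (conjCi C) scaleNr.
Qed.

Lemma czmon_p l : czmon U_(rshift M l) = pconj (zX R l).
Proof. by rewrite pconj_zX; exact: zsubst_Xr. Qed.

Lemma czmon_I l : gen_I R l = czmon (mnm_I l).
Proof. by rewrite czmonD czmon_q czmon_p. Qed.

Lemma czmon_pair (x y : 'I_M -> nat) : czmon (mnm_pair x y) =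
  \prod_l (zX R l ^+ x l * pconj (zX R l) ^+ y l).
Proof.
have -> : czmon (mnm_pair x y) = \prod_l (czmon U_(lshift M l) ^+ x l *
   czmon U_(rshift M l) ^+ y l) by exact: zmon_pair.
by apply: eq_bigr => l _; rewrite czmon_q czmon_p.
Qed.

Lemma czmon_vec a : gen_A R a = czmon (mnm_vec a).
Proof. by rewrite czmon_pair. Qed.

Lemma H0_oscillator (n : 'I_M -> nat) : H0 R n = oscillator inv_sqrt2 imag n.
Proof.
have rr : inv_sqrt2 * inv_sqrt2 = 2^-1.
  have two0 : (2 : C) != 0 by rewrite pnatr_eq0.
  by apply: (mulIf two0); rewrite inv_sqrt2_sqr mulVf.
rewrite /H0 /oscillator scaler_sumr; apply: eq_bigr => l _.
by rewrite (zmon_I_quadratic _ imag_sqr) rr !scalerA mulrC.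
Qed.

Lemma FalgP (n : 'I_M -> nat) f : f \in Falg R n <->
  canonical_bracket (fun l => mderiv (rshift M l)) (fun l => mderiv (lshift M l))
    f (oscillator inv_sqrt2 imag n) = 0.
Proof. by rewrite inE H0_oscillator; split=> [/eqP|f0] //; apply/eqP. Qed.

Lemma pconj_gen_I l : pconj (gen_I R l) = gen_I R l.
Proof. by rewrite /gen_I pconjM pconjK mulrC. Qed.

Lemma pconj_gen_A a : pconj (gen_A R a) = gen_A R (- a).
Proof.
rewrite /gen_A pospartN negpartN rmorph_prod; apply: eq_bigr => l _ /=.
by rewrite rmorphM !rmorphXn /= pconjK mulrC.
Qed.

Lemma pconj_H0 (n : 'I_M -> nat) : pconj (H0 R n) = H0 R n.
Proof.
rewrite H0_oscillator raddf_sum /=; apply: eq_bigr => l _.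
by rewrite /pconj map_mpolyZ rmorph_nat -/(pconj _) -/(czmon _) -czmon_I pconj_gen_I.
Qed.

(** Closure under products is the Leibniz rule, closure under the bracket is the Jacobi identity
    with third argument H_0, and closure under conjugation holds because H_0 is real. *)
Lemma Falg_involutive (n : 'I_M -> nat) :
  involutive_poisson_algebra (Falg R n) (@pbracket R M) (@pconj R M).
Proof.
have FE f : (f \in Falg R n) = (br f (H0 R n) == 0) by [].
have FM f g : f \in Falg R n -> g \in Falg R n -> f * g \in Falg R n.
  rewrite !FE => /eqP f0 /eqP g0; apply/eqP.
  rewrite pbracketC pbracketM !(pbracketC (H0 R n)) f0 g0.
  by rewrite oppr0 mul0r mulr0 addr0 oppr0.
have FP c f g : f \in Falg R n -> g \in Falg R n -> c *: f + g \in Falg R n.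
  rewrite !FE => /eqP f0 /eqP g0; apply/eqP.
  by rewrite pbracketDl f0 g0 scaler0 addr0.
have F1 : 1 \in Falg R n.
  by apply/FalgP/bracket_one0; exact: inv_sqrt2_sqr.
split.
- by split.
- move=> f g; rewrite !FE => /eqP f0 /eqP g0; apply/eqP.
  have := pbracket_jacobi f g (H0 R n).
  rewrite g0 (pbracketC (H0 R n) f) f0 oppr0.
  have b0 h : br h 0 = 0.
    by have := pbracketDr (-1) 0 0 h; rewrite scaler0 addr0 scaleN1r addNr.
  by rewrite !b0 !add0r => /eqP; rewrite pbracketC oppr_eq0 => /eqP.
- by move=> c f g h _ _ _; apply: pbracketDl.
- by move=> f g _ _; apply: pbracketC.
- by move=> f g h _ _ _; apply: pbracketM.
- by move=> f g h _ _ _; apply: pbracket_jacobi.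
- move=> f; rewrite !FE => /eqP f0; apply/eqP.
  by rewrite -(pconj_H0 n) -pconj_br f0 /pconj raddf0.
- by move=> f _; apply: pconjK.
- by move=> c f g _ _; apply: pconjP.
- by move=> f g _ _; apply: pconjM.
- by move=> f g _ _; apply: pconj_br.
Qed.

Lemma generators_czmon (Gamma : seq (Zvec M)) :
  generators R Gamma = map czmon (irr_seq Gamma).
Proof.
rewrite /generators /irr_seq map_cat -!map_comp.
by congr (_ ++ _); apply: eq_map => x /=; rewrite (czmon_vec, czmon_I).
Qed.

Lemma gen_A_prod (Gamma : seq (Zvec M)) (w : Zvec M -> nat) :
  \prod_(c <- Gamma) gen_A R c ^+ w c = czmon (\sum_(c <- Gamma) mnm_vec c *+ w c)%MM.
Proof.
have -> : czmon (\sum_(c <- Gamma) mnm_vec c *+ w c)%MM =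
  \prod_(c <- Gamma) czmon (mnm_vec c *+ w c)%MM by exact: zmon_sum.
apply: eq_bigr => c _; rewrite czmon_vec.
by symmetry; exact: zmon_mulm.
Qed.

Lemma gen_I_exp_czmon (k : Nvec M) : gen_I_exp R k = czmon (mnm_pair k k).
Proof. by rewrite czmon_pair; apply: eq_bigr => l _; rewrite exprMn. Qed.

Lemma pbracket_gen_AI a l : br (gen_A R a) (gen_I R l) = (iC * (a l)%:~R) *: gen_A R a.
Proof.
rewrite czmon_vec czmon_I.
apply: etrans (canonical_bracket_zmon_I imag inv_sqrt2_sqr (mnm_vec a) l) _.
by rewrite !mnm_pairE (pos_negpart a l) rmorphB.
Qed.

Lemma pbracket_gen_II l j : br (gen_I R l) (gen_I R j) = 0.
Proof.
rewrite !czmon_I.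
apply: etrans (canonical_bracket_zmon_I imag inv_sqrt2_sqr (mnm_I l) j) _.
by rewrite mnm_I_l mnm_I_r subrr mulr0 scale0r.
Qed.

Lemma pbracket_gen_AA a b (G : 'X_{1..M + M}) :
  (mnm_vec a + mnm_vec b = G + mnm_pair (circ_add a b) (circ_add a b))%MM ->
  br (gen_A R a) (gen_A R b) = iC *: (eval_I R (Phi_circ a b) * czmon G).
Proof.
have eI : @gen_I R M = fun l => czmon (mnm_I l).
  by apply: boolp.funext => l; apply: czmon_I.
move=> e; rewrite !czmon_vec /eval_I eI.
exact: (bracket_zmon_vec imag inv_sqrt2_sqr e).
Qed.

End ConcreteOscillator.

Theorem theorem2p1 (R : realType) (M : nat) (n : 'I_M -> nat)
    (M_ge2 : (2 <= M)%N) (n_gt0 : forall l : 'I_M, (0 < n l)%N) :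
  exists Gamma : seq (Zvec M),
    (* Gamma enumerates Gamma_n, which is thus finite *)
    (uniq Gamma /\ forall a : Zvec M, a \in Gamma <-> minimal_solution n a) /\
    (involutive_poisson_algebra (Falg R n) (@pbracket R M) (@pconj R M) /\
     finitely_generated (Falg R n)) /\
    generates (Falg R n) (generators R Gamma) /\
    (* conjugation *)
    (forall a : Zvec M, a \in Gamma ->
       - a \in Gamma /\ pconj (gen_A R a) = gen_A R (- a)) /\
    (forall j : 'I_M, pconj (gen_I R j) = gen_I R j) /\
    (* expansions exist; constraints and brackets hold for any chosen one, with
       Phi a polynomial with integer coefficients *)
    (exists mu : Zvec M -> Zvec M -> Zvec M -> nat, is_expansion Gamma mu) /\
    (forall a b : Zvec M, a \in Gamma -> b \in Gamma ->
       exists Phi : {mpoly int[M]},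
         (forall lambda : 'I_M -> R, (forall l : 'I_M, lambda l != 0) ->
            mmap intr lambda Phi = PhiCirc a b lambda) /\
         (forall mu : Zvec M -> Zvec M -> Zvec M -> nat, is_expansion Gamma mu ->
            gen_A R a * gen_A R b
              = gen_I_exp R (circ_add a b)
                  * \prod_(c <- Gamma) gen_A R c ^+ mu a b c /\
            pbracket (gen_A R a) (gen_A R b)
              = iC *: (eval_I R Phi * \prod_(c <- Gamma) gen_A R c ^+ mu a b c))) /\
    (forall (a : Zvec M) (j : 'I_M), a \in Gamma ->
       pbracket (gen_A R a) (gen_I R j) = (iC * (a j)%:~R) *: gen_A R a) /\
    (forall l j : 'I_M, pbracket (gen_I R l) (gen_I R j) = 0) /\
    (* the generators are pairwise distinct, and their number is the functional
       dimension *)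
    (uniq (generators R Gamma) /\ size (generators R Gamma) = (size Gamma + M)%N) /\
    functional_dimension (Falg R n) (size Gamma + M).
Proof.
have [Gamma Gamma_uniq GammaP] := minimal_solution_finite n_gt0.
have gensE := generators_czmon R Gamma.
have gen_irr : generates (Falg R n) (generators R Gamma).
  rewrite gensE.
  exact: (generates_irr (@inv_sqrt2_sqr R) (@imag_sqr R) n_gt0 GammaP (FalgP n)).
exists Gamma; split; first by [].
split; first by split; [exact: Falg_involutive | exists (generators R Gamma)].
split; first exact: gen_irr.
split=> [a aG|].
  by split; [apply/GammaP/minimal_solutionN/GammaP | apply: pconj_gen_A].
split; first exact: pconj_gen_I.
split; first exact: (expansion_exists Gamma_uniq GammaP).
split=> [a b aG bG|].
  exists (Phi_circ a b); split=> [lambda l0|mu /is_expansionP mu_exp].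
    exact: mmap_Phi_circE.
  have e := mu_exp a b aG bG; rewrite gen_A_prod; split.
    (* All factors are monomials in z and conj z, so the constraint is the expansion read as an
       identity of exponents. *)
    rewrite (czmon_vec R a) (czmon_vec R b) gen_I_exp_czmon.
    by apply: etrans (esym (czmonD _ _ _)) _; rewrite e addmC czmonD.
  exact: pbracket_gen_AA.
split=> [a j _|]; first exact: pbracket_gen_AI.
split; first exact: pbracket_gen_II.
split; last first.
  exact: (functional_dimension_irr (@inv_sqrt2_sqr R) (@imag_sqr R) n_gt0
    Gamma_uniq GammaP (FalgP n)).
rewrite gensE size_map size_irr_seq (map_inj_uniq (@czmon_inj R M)).
by rewrite irr_seq_uniq.
Qed.
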